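(* Let $c\in\mathbb{R}$, $r\ge 0$ an integer, $M_0,\dots,M_r\ge 0$, and let $\mu$ be a finite positive Borel measure supported on an infinite subset of $\mathbb{R}$. Let $\{p_n\}_{n\ge0}$ be the orthonormal polynomials with respect to $\mu$, $\{p_n^{[2j]}\}_{n\ge0}$ the orthonormal polynomials with respect to $(x-c)^{2j}\,d\mu(x)$, and $\{q_n\}_{n\ge0}$ the orthonormal polynomials with respect to the discrete Sobolev inner product $\langle p,q\rangle=\int p(x)q(x)\,d\mu(x)+\sum_{i=0}^r M_i\,p^{(i)}(c)\,q^{(i)}(c)$. Assume that $$p_n(c)\,p_{n-1}^{[2]}(c)\cdots p_{n-(r+1)}^{[2(r+1)]}(c)\neq 0\qquad\text{for } n\ge r+1.$$ Then for each $n\ge r+1$ there exists a family of real coefficients $(\lambda_{j,n})_{j=0}^{r+1}$, not identically zero, such that $$q_n(x)=\sum_{j=0}^{r+1}\lambda_{j,n}\,(x-c)^j\,p_{n-j}^{[2j]}(x).$$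
   Context: All moments of $\mu$ are finite. ''Orthonormal polynomials'' with respect to an inner product means the sequence of polynomials, the $n$-th one of exact degree $n$ with positive leading coefficient, that are orthonormal for that inner product. $p_n^{[0]}=p_n$. *)

(* Defs.v *)
From mathcomp Require Import all_boot all_order all_algebra.
From mathcomp Require Import all_classical all_reals all_analysis.

Set Implicit Arguments.
Unset Strict Implicit.
Unset Printing Implicit Defensive.

Import Order.TTheory GRing.Theory Num.Theory.
Import numFieldNormedType.Exports.

Local Open Scope classical_set_scope.
Local Open Scope ring_scope.

(* The topological support: points all of whose open neighbourhoods are charged *)
Definition msupport (R : realType)
    (mu : {measure set (measurableTypeR R) -> \bar R}) : set R :=
  [set x : R | forall U : set R, open U -> U x -> (0 < mu U)%E].

Definition finite_moments (R : realType)
    (mu : {measure set (measurableTypeR R) -> \bar R}) : Prop :=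
  forall k : nat, mu.-integrable setT (fun x : measurableTypeR R => ((x : R) ^+ k)%:E).

(* The inner product of the measure w(x) dmu(x) *)
Definition weighted_ip (R : realType)
    (mu : {measure set (measurableTypeR R) -> \bar R}) (w : R -> R)
    (p q : {poly R}) : R :=
  \int[mu]_x (p.[x] * q.[x] * w x).

Definition sobolev_ip (R : realType)
    (mu : {measure set (measurableTypeR R) -> \bar R}) (c : R) (r : nat)
    (M : 'I_r.+1 -> R) (p q : {poly R}) : R :=
  \int[mu]_x (p.[x] * q.[x]) + \sum_(i < r.+1) M i * p^`(i).[c] * q^`(i).[c].

Definition orthonormal_polys (R : realType)
    (ip : {poly R} -> {poly R} -> R) (p : nat -> {poly R}) : Prop :=
  [/\ forall n, size (p n) = n.+1,
      forall n, 0 < lead_coef (p n)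
    & forall m n, ip (p m) (p n) = (m == n)%:R].

(* Main.v *)
Require Import Defs.
From mathcomp Require Import all_boot all_order all_algebra.
From mathcomp Require Import all_classical all_reals all_analysis.
From mathcomp Require Import zify ring.
Set Implicit Arguments.
Unset Strict Implicit.
Unset Printing Implicit Defensive.
Import Order.TTheory GRing.Theory Num.Theory.
Import numFieldNormedType.Exports.
Local Open Scope classical_set_scope.
Local Open Scope ring_scope.

(* Put u_j = (x - c)^j p_{n-j}^{[2j]}, of degree n.  The non-vanishing condition
   says that u_j vanishes at c to order exactly j, so a combination of
   u_0, ..., u_r agrees with q_n at c up to order r, and u_{r+1} then corrects
   the leading coefficient.  The remainder is (x - c)^{r+1} h with
   deg h < n - r - 1.  Both q_n and all u_j are mu-orthogonal to
   (x - c)^{r+1} k for deg k < n - r - 1, because the point masses do not see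
   such multiples; hence h is orthogonal to these k for (x - c)^{2(r+1)} dmu,
   and h = 0. *)

Lemma poly_basis_expansion (R : fieldType) (p : nat -> {poly R})
    (size_p : forall n, size (p n) = n.+1) (n : nat) (f : {poly R}) :
  (size f <= n)%N -> exists a : nat -> R, f = \sum_(i < n) a i *: p i.
Proof.
elim: n f => [|n IHn] f sf.
  exists (fun=> 0); rewrite big_ord0; apply/eqP.
  by rewrite -size_poly_leq0.
have pn0 : (p n)`_n != 0.
  by rewrite -[n in _`_n]/(n.+1.-1) -(size_p n) -lead_coefE lead_coef_eq0
    -size_poly_gt0 size_p.
(* Subtracting [b *: p n] cancels the coefficient of degree [n], so the induction hypothesis applies
   to the rest. *)
pose b := f`_n / (p n)`_n.
have [|a fE] := IHn (f - b *: p n).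
  apply/leq_sizeP => i; rewrite leq_eqVlt => /predU1P[<-|ltni].
    by rewrite coefB coefZ divfK ?subrr.
  by rewrite coefB coefZ !nth_default ?mulr0 ?subrr ?size_p // (leq_trans sf).
exists (fun i => if i == n then b else a i).
rewrite big_ord_recr /= eqxx; apply/eqP; rewrite -subr_eq fE; apply/eqP.
by apply: eq_bigr => i _; rewrite ltn_eqF.
Qed.

Lemma scalar_sum (R : nzRingType) (V : lmodType R) (L : V -> R) :
  scalar L -> forall n (a : nat -> R) (v : nat -> V),
  L (\sum_(i < n) a i *: v i) = \sum_(i < n) a i * L (v i).
Proof.
move=> L_lin n a v; elim: n => [|n IHn].
  (* Linearity at scalar -1 and zero vectors gives [L 0 = - L 0 + L 0 = 0]. *)
  by have := L_lin (-1) 0 0; rewrite !big_ord0 scaler0 addr0 mulN1r addNr.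
by rewrite !big_ord_recr /= addrC L_lin IHn addrC.
Qed.

Lemma orthonormal_polys_orthogonal (R : realType)
    (ip : {poly R} -> {poly R} -> R) (p : nat -> {poly R}) :
  orthonormal_polys ip p -> forall n, scalar (ip (p n)) ->
  forall f : {poly R}, (size f <= n)%N -> ip (p n) f = 0.
Proof.
move=> [size_p _ ip_p] n ip_lin f /(poly_basis_expansion size_p)[a ->].
rewrite scalar_sum // big1 // => i _.
by rewrite ip_p gtn_eqF ?mulr0.
Qed.

(** Pairing with [p i] reads off the [i]-th coefficient of [f] in the basis [p], so all these
    coefficients vanish. *)
Lemma orthonormal_polys_nondegenerate (R : realType)
    (ip : {poly R} -> {poly R} -> R) (p : nat -> {poly R}) :
  orthonormal_polys ip p -> (forall f, scalar (ip f)) ->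
  forall n (f : {poly R}), (size f <= n)%N ->
    (forall g : {poly R}, (size g <= n)%N -> ip g f = 0) -> f = 0.
Proof.
move=> [size_p _ ip_p] ip_lin n f /(poly_basis_expansion size_p)[a fE] ip0.
rewrite fE big1 // => i _; suff -> : a i = 0 by rewrite scale0r.
have := ip0 (p i); rewrite size_p => /(_ (ltn_ord i)).
rewrite fE scalar_sum // (bigD1 i) //= ip_p eqxx mulr1 big1 ?addr0 //.
by move=> j ji; rewrite ip_p eq_sym -[RHS](mulr0 (a j)) (negPf (_ : val j != i)).
Qed.

(** Each derivative lowers the order of the zero at [c] by at most one. This is what makes the point
    masses vanish on multiples of $(x-c)^{r+1}$. *)
Lemma derivn_XsubC_exp_mul_root (R : comNzRingType) (c : R) (i m : nat)
    (k : {poly R}) : (i < m)%N -> ((('X - c%:P) ^+ m * k)^`(i)).[c] = 0.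
Proof.
elim: i m k => [|i IHi] [|m] k // im.
  by rewrite derivn0 exprS -mulrA hornerM hornerXsubC subrr mul0r.
rewrite derivSn.
have -> : ((('X - c%:P) ^+ m.+1 * k)^`() =
    ('X - c%:P) ^+ m * (k *+ m.+1 + ('X - c%:P) * k^`())).
  rewrite derivM deriv_exp derivB derivX derivC subr0 mul1r exprSr.
  by rewrite mulrnAl -mulrnAr -mulrA -mulrDr.
exact: IHi.
Qed.

Lemma integrable_poly (R : realType)
    (mu : {measure set (measurableTypeR R) -> \bar R}) :
  finite_moments mu -> forall f : {poly R},
  mu.-integrable setT (fun x : measurableTypeR R => (f.[x : R])%:E).
Proof.
move=> mu_moments f.
apply: (eq_integrable measurableT
  (fun x : measurableTypeR R => \sum_(i < size f) ((f`_i)%:E * ((x : R) ^+ i)%:E)))%E.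
  move=> x _; rewrite horner_coef -sumEFin.
  by apply: eq_bigr => i _; rewrite EFinM.
by apply: integrable_sum => // i _; apply: integrableZl.
Qed.

Lemma Rintegral_poly_scalar (R : realType)
    (mu : {measure set (measurableTypeR R) -> \bar R}) :
  finite_moments mu -> scalar (fun f : {poly R} => \int[mu]_x f.[x]).
Proof.
move=> mu_moments a f g.
rewrite -RintegralZl ?integrable_poly // -RintegralD ?integrable_poly //.
  by apply: eq_Rintegral => x _; rewrite hornerD hornerZ.
apply: (eq_integrable measurableT (fun x : measurableTypeR R => ((a *: f).[x : R])%:E)).
  by move=> x _; rewrite hornerZ.
exact: integrable_poly.
Qed.

Theorem theorem1 (R : realType)
    (c : R) (r : nat) (M : 'I_r.+1 -> R) (M_ge0 : forall i, 0 <= M i)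
    (mu : {finite_measure set (measurableTypeR R) -> \bar R})
    (mu_moments : finite_moments mu)
    (mu_support : infinite_set (msupport mu))
    (p : nat -> {poly R})
    (p_orthonormal :
       orthonormal_polys (fun f g => \int[mu]_x (f.[x] * g.[x])) p)
    (* P j n is the n-th orthonormal polynomial for (x - c)^(2j) dmu(x) *)
    (P : nat -> nat -> {poly R})
    (P_0 : P 0%N = p)
    (P_orthonormal : forall j,
       orthonormal_polys (weighted_ip mu (fun x => (x - c) ^+ (2 * j))) (P j))
    (q : nat -> {poly R})
    (q_orthonormal : orthonormal_polys (sobolev_ip mu c M) q)
    (nonvanishing : forall n, (r.+1 <= n)%N ->
       \prod_(j < r.+2) (P j (n - j)%N).[c] != 0) :
  forall n, (r.+1 <= n)%N ->
    exists lambda : 'I_r.+2 -> R,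
      (exists j, lambda j != 0) /\
      q n = \sum_(j < r.+2) lambda j *: (('X - c%:P) ^+ j * P j (n - j)%N).
Proof.
move=> n ltrn.
pose I (f : {poly R}) := \int[mu]_x f.[x].
have I_lin : scalar I by exact: Rintegral_poly_scalar.
have wipE j f g : weighted_ip mu (fun x => (x - c) ^+ (2 * j)) f g =
    I (f * g * ('X - c%:P) ^+ (2 * j)).
  by apply: eq_Rintegral => x _; rewrite !hornerM horner_exp hornerXsubC.
have wip_lin j f : scalar (weighted_ip mu (fun x => (x - c) ^+ (2 * j)) f).
  move=> a g h; rewrite !wipE -I_lin; congr I.
  by rewrite mulrDr mulrDl -scalerAr -scalerAl.
have sipE f g : sobolev_ip mu c M f g =
    I (f * g) + \sum_(i < r.+1) M i * f^`(i).[c] * g^`(i).[c].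
  by congr (_ + _); apply: eq_Rintegral => x _; rewrite hornerM.
have sip_lin f : scalar (sobolev_ip mu c M f).
  move=> a g h; rewrite !sipE mulrDr -scalerAr I_lin mulrDr addrACA mulr_sumr.
  congr (_ + _); rewrite -big_split; apply: eq_bigr => i _ /=.
  by rewrite derivnD derivnZ hornerD hornerZ mulrDr mulrCA.
pose y := 'X - c%:P : {poly R}.
pose u j := y ^+ j * P j (n - j)%N.
have size_P j m : size (P j m) = m.+1 by have [] := P_orthonormal j.
have size_yM j (f : {poly R}) : f != 0 -> size (y ^+ j * f) = (j + size f)%N.
  move=> f0; rewrite mulrC size_Mmonic ?monic_exp ?monicXsubC //.
  by rewrite size_exp_XsubC addnS addnC.
have size_u j : (j <= n)%N -> size (u j) = n.+1.
  by move=> jn; rewrite size_yM -?size_poly_gt0 size_P // addnS subnKC.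
have q_orth (k : {poly R}) : (size k <= n - r.+1)%N -> I (q n * (y ^+ r.+1 * k)) = 0.
  move=> sk; have := orthonormal_polys_orthogonal q_orthonormal (sip_lin (q n)).
  move=> /(_ (y ^+ r.+1 * k)); rewrite sipE big1 ?addr0; last first.
    by move=> i _; rewrite derivn_XsubC_exp_mul_root ?mulr0.
  apply; have [->|k0] := eqVneq k 0; first by rewrite mulr0 size_poly0.
  by rewrite size_yM // -leq_subRL.
(* Regroup $(x-c)^j (x-c)^{r+1}$ as $(x-c)^{2j} (x-c)^{r+1-j}$: the first factor is the weight of
   [P j], and $(x-c)^{r+1-j} k$ has degree below $n-j$. *)
have u_orth j (k : {poly R}) : (j <= r.+1)%N -> (size k <= n - r.+1)%N ->
    I (u j * (y ^+ r.+1 * k)) = 0.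
  move=> jr sk.
  have := orthonormal_polys_orthogonal (P_orthonormal j) (wip_lin j _).
  move=> /(_ (n - j)%N (y ^+ (r.+1 - j) * k)); rewrite wipE => <-.
    congr I; rewrite /u -{1}(subnKC jr) exprD mul2n -addnn exprD -/y.
    by rewrite -[in LHS]mulrA; ring.
  have [->|k0] := eqVneq k 0; first by rewrite mulr0 size_poly0.
  rewrite size_yM //; lia.
have taylor k : (k <= r.+1)%N -> exists (a : nat -> R) (g : {poly R}),
    q n = \sum_(j < k) a j *: u j + y ^+ k * g.
  elim: k => [|k IHk] kr.
    by exists (fun=> 0), (q n); rewrite big_ord0 add0r mul1r.
  have [a [g qE]] := IHk (ltnW kr).
  have Pc : (P k (n - k)%N).[c] != 0.
    have /prodf_neq0/(_ (Ordinal (leqW kr : (k < r.+2)%N)) isT) := nonvanishing n ltrn.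
    by [].
  (* The coefficient of [u k] is chosen to make the remaining cofactor vanish at [c], which frees
     one more factor [y]. *)
  pose b := g.[c] / (P k (n - k)%N).[c].
  have /factor_theorem[h hE] : root (g - b *: P k (n - k)%N) c.
    by rewrite rootE hornerD hornerN hornerZ divfK ?subrr.
  exists (fun j => if j == k then b else a j), h.
  rewrite big_ord_recr /= eqxx qE.
  rewrite [in RHS](eq_bigr (fun j : 'I_k => a j *: u j)); last first.
    by move=> i _; rewrite ltn_eqF.
  rewrite -addrA; congr (_ + _).
  have -> : g = b *: P k (n - k)%N + h * y by rewrite -hE addrC subrK.
  by rewrite mulrDr -scalerAr exprSr mulrAC mulrA.
have [a [g qE]] := taylor r.+1 (leqnn _).
have size_q : size (q n) = n.+1 by case: q_orthonormal.
(* Here [y ^+ r.+1 * g] is a combination of [q n] and the [u j], all of degree [n]. *)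
have size_g : (size g <= (n - r.+1).+1)%N.
  have [->|g0] := eqVneq g 0; first by rewrite size_poly0.
  suff : (size (y ^+ r.+1 * g)%R <= n.+1)%N by rewrite size_yM //; lia.
  have -> : y ^+ r.+1 * g = q n - \sum_(j < r.+1) a j *: u j.
    by rewrite qE addrAC subrr add0r.
  rewrite (leq_trans (size_polyD _ _)) // geq_max size_q leqnn size_polyN.
  apply: (leq_trans (size_sum _ _ _)); apply/bigmax_leqP => i _.
  by rewrite (leq_trans (size_scale_leq _ _)) // size_u //; have := ltn_ord i; lia.
(* In the basis [P r.+1], the top term of [g], multiplied by [y ^+ r.+1], is a multiple of [u r.+1];
   the lower terms form [h]. *)
have [b gE] := poly_basis_expansion (size_P r.+1) size_g.
pose h := \sum_(i < n - r.+1) b i *: P r.+1 i.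
pose lambda j := if j == r.+1 then b (n - r.+1)%N else a j.
have qhE : q n = \sum_(j < r.+2) lambda j *: u j + y ^+ r.+1 * h.
  rewrite qE gE (big_ord_recr (n - r.+1)) -/h mulrDr -scalerAr addrA addrAC; congr (_ + _).
  rewrite [RHS]big_ord_recr /= /lambda eqxx; congr (_ + _).
  by apply: eq_bigr => i _; rewrite ltn_eqF.
have h0 : h = 0.
  apply: (orthonormal_polys_nondegenerate (P_orthonormal r.+1) (wip_lin _)
    (n := n - r.+1)) => [|k sk].
    apply: (leq_trans (size_sum _ _ _)); apply/bigmax_leqP => i _.
    by rewrite (leq_trans (size_scale_leq _ _)) // size_P.
  (* [J] kills [q n] and every [u j], hence also [y ^+ r.+1 * h]; that value is the pairing of [k]
     with [h] for the weight $(x-c)^{2(r+1)}$. *)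
  pose J f := I (f * (y ^+ r.+1 * k)).
  have J_lin : scalar J by move=> d f g'; rewrite /J mulrDl -scalerAl I_lin.
  have <- : J (y ^+ r.+1 * h) = 0.
    have := q_orth k sk; rewrite -/(J _) qhE -[X in X + _]scale1r J_lin.
    rewrite scalar_sum // mul1r big1 ?add0r // => i _.
    by rewrite /J u_orth ?mulr0 // -ltnS.
  by rewrite wipE mul2n -addnn exprD -/y /J; congr I; ring.
move: qhE; rewrite h0 mulr0 addr0 => qhE.
exists (fun j : 'I_r.+2 => lambda j); split; last exact: qhE.
(* If all coefficients were zero, [q n] would be zero, against its size [n.+1]. *)
apply/not_existsP => lambda0; have := size_q; rewrite qhE big1 ?size_poly0 // => j _.
by have /negP/negPn/eqP -> := lambda0 j; rewrite scale0r.
Qed.
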